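(* Consider a system whose communication graph $G$ is a simple cycle, and let $a$ and $b$ be its two rings. Let $N(a)$ and $N(b)$ be the numbers of robots in $a$ and $b$, respectively, in a synchronized communication system on $G$ (before any robot leaves). Then the isolation-resilience of $G$ is $\min\{N(a),N(b)\}-1$.
   Context: Model. A system consists of pairwise disjoint unit circles $C_1,\dots,C_n$ in the plane (trajectories) and a communication range $r>0$. Its communication graph $G$ has vertex set $\{C_1,\dots,C_n\}$, $C_i,C_j$ adjacent iff the distance between their centres is at most $2+r$. Positions on a circle are angles (mod $2\pi$). For an edge $(i,j)$, the link position $\phi_{ij}$ is the angle of the point of $C_i$ closest to $C_j$. A schedule $F=(f,g)$ assigns each circle a starting angle $f(C_i)$ and direction $g(C_i)\in\{1,-1\}$; a robot following it on $C_i$ is at $f(C_i)+g(C_i)2\pi t$ at time $t$. $F$ is a synchronization schedule if $g(C_i)=-g(C_j)$ for adjacent circles and robots following $F$ on adjacent $C_i,C_j$ are at $\phi_{ij},\phi_{ji}$ at exactly the same times. A synchronized communication system (SCS) on $G$ consists of $n$ robots, initially one per circle, following a synchronization schedule, with the switching rule: when a robot on $C_i$ reaches $\phi_{ij}$ and $C_j$ is empty, it instantly passes to $C_j$ and follows the schedule of $C_j$; if $C_j$ has a robot, they meet and each stays on its circle. A partial SCS arises by letting some robots leave (possibly at different times); remaining robots never leave. A surviving robot $u$ starves if every time $u$ arrives at a link position $\phi_{ij}$ of its current circle $C_i$, the circle $C_j$ is empty; the system is in starvation state if all surviving robots starve. The isolation-resilience of $G$ is the largest $k$ such that, whichever $k$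 robots leave an SCS on $G$, the system does not fall into starvation state. Rings. Given the directions $g$, trace a point moving along a circle $C_i$ in direction $g(C_i)$; whenever it reaches a link position $\phi_{ij}$ of its current circle, it passes to $C_j$ at $\phi_{ji}$ and continues in direction $g(C_j)$. The closed curve traced is a ring; the circles decompose into rings overlapping only at link positions. A robot is in a ring if it lies on a point of it. When $G$ is a cycle there are exactly two rings.
   Formalization: A robot starting exactly on a link position lies on both rings; it is counted only in the ring it follows just after time 0, since counting it in both makes the claim false (four circles in a square, all robots starting at link positions). Resilience is taken for the given SCS, for every schedule. *)

(* Defs.v *)
From Stdlib Require Import Reals ClassicalEpsilon.
From mathcomp Require Import all_boot.
Set Implicit Arguments. Unset Strict Implicit. Unset Printing Implicit Defensive.
Local Open Scope R_scope.

Definition pb (P : Prop) : bool :=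
  if excluded_middle_informative P then true else false.

Definition pt := (R * R)%type.
Definition dist (p q : pt) : R :=
  sqrt ((fst p - fst q) ^ 2 + (snd p - snd q) ^ 2).

Section Model.
Variable n : nat.
Variable c : 'I_n -> pt.     (* centres of the unit circles C_0 .. C_{n-1} *)
Variable r : R.

Definition disjoint_unit_circles : Prop :=
  forall i j : 'I_n, i <> j -> 2 < dist (c i) (c j).

Definition comm_adj (i j : 'I_n) : Prop :=
  i <> j /\ dist (c i) (c j) <= 2 + r.

(* [G] is the simple cycle i -> nxt i -> nxt (nxt i) -> ... through all
   vertices (together with 3 <= n). *)
Definition cycle_order (nxt : 'I_n -> 'I_n) : Prop :=
  injective nxt /\
  (forall i j : 'I_n, exists k : nat, iter k nxt i = j) /\
  (forall i j : 'I_n, comm_adj i j <-> (j = nxt i \/ i = nxt j)).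

(* angle theta (mod 2 pi) is the direction of the nonzero vector v *)
Definition is_dir (theta : R) (v : pt) : Prop :=
  cos theta * sqrt (fst v ^ 2 + snd v ^ 2) = fst v /\
  sin theta * sqrt (fst v ^ 2 + snd v ^ 2) = snd v.

Variables f g : 'I_n -> R.

Definition sched_pos (i : 'I_n) (t : R) : R := f i + g i * 2 * PI * t.

(* a robot following F on C_i is at the link position phi_ij at time t;
   phi_ij is the angle of the point of C_i closest to C_j, i.e. the
   direction of c_j - c_i *)
Definition at_link (i j : 'I_n) (t : R) : Prop :=
  is_dir (sched_pos i t) (fst (c j) - fst (c i), snd (c j) - snd (c i)).

Definition sync_schedule : Prop :=
  (forall i, g i = 1 \/ g i = -1) /\
  (forall i j, comm_adj i j ->
     g i = - g j /\ (forall t, at_link i j t <-> at_link j i t)).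

(** Rings of a cycle.  Given the cycle order [nxt], the ring traced by a point
    that on C_i moves towards phi_{i,nxt i} (then passes to C_{nxt i}) is ring
    a; the other one is ring b.  A robot starting (time 0) on C_i is counted in
    the ring it traces next, i.e. according to the first link position it
    reaches strictly after time 0. *)
Definition first_link (i j : 'I_n) : Prop :=
  exists s, 0 < s /\ at_link i j s /\
    (forall s' k, 0 < s' < s -> comm_adj i k -> ~ at_link i k s').

Definition N_ring_a (nxt : 'I_n -> 'I_n) : nat :=
  #|[set i : 'I_n | pb (first_link i (nxt i))]|.

Definition N_ring_b (nxt : 'I_n -> 'I_n) : nat :=
  #|[set i : 'I_n | pb (exists j, nxt j = i /\ first_link i j)]|.

(** Partial SCS.  Robots are named by their initial circle (robot u starts on
    C_u).  The robots of [S] leave, robot u at time [tau u >= 0]; a robot is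
    present at time t iff it is not in S or t < tau u.
    [loc t u] is the circle of robot u at time t (after any switch at t). *)
Definition alive (S : {set 'I_n}) (tau : 'I_n -> R) (u : 'I_n) (t : R) : Prop :=
  u \notin S \/ t < tau u.

Definition left_loc (loc : R -> 'I_n -> 'I_n) (t : R) (u i : 'I_n) : Prop :=
  exists eps, 0 < eps /\ forall s, t - eps < s < t -> loc s u = i.

Definition empty_at (S : {set 'I_n}) (tau : 'I_n -> R)
    (loc : R -> 'I_n -> 'I_n) (t : R) (j : 'I_n) : Prop :=
  forall v, alive S tau v t -> ~ left_loc loc t v j.

Definition run (S : {set 'I_n}) (tau : 'I_n -> R) (loc : R -> 'I_n -> 'I_n) : Prop :=
  (forall t u, t < 0 -> loc t u = u) /\
  (forall t u, exists eps, 0 < eps /\ forall s, t <= s < t + eps -> loc s u = loc t u) /\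
  (forall t u, exists i, left_loc loc t u i) /\
  (forall t u i, alive S tau u t -> left_loc loc t u i ->
     (forall j, comm_adj i j -> at_link i j t -> empty_at S tau loc t j ->
        loc t u = j) /\
     ((forall j, comm_adj i j -> at_link i j t -> ~ empty_at S tau loc t j) ->
        loc t u = i)).

Definition starvation_from (S : {set 'I_n}) (tau : 'I_n -> R)
    (loc : R -> 'I_n -> 'I_n) (T : R) : Prop :=
  forall u, u \notin S -> forall t i j, T <= t -> left_loc loc t u i ->
    comm_adj i j -> at_link i j t -> empty_at S tau loc t j.

Definition falls_into_starvation (S : {set 'I_n}) (tau : 'I_n -> R)
    (loc : R -> 'I_n -> 'I_n) : Prop :=
  exists T, starvation_from S tau loc T.

Definition resilient (k : nat) : Prop :=
  (k <= n)%N /\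
  forall (S : {set 'I_n}) (tau : 'I_n -> R), #|S| = k ->
    (forall u, u \in S -> 0 <= tau u) ->
    forall loc, run S tau loc -> ~ falls_into_starvation S tau loc.

Definition isolation_resilience (k : nat) : Prop :=
  resilient k /\ forall k', resilient k' -> (k' <= k)%N.

End Model.

(* Main.v *)
(** A circle belongs, at a given time, to the ring of the link position that a
    robot on it reaches next.  Link positions are reached with period 1, so at
    integer times every circle has the same ring as at time 0.

    Two robots are never on the same circle.  If fewer than [min N(a) N(b)] of them
    have left, then at every large integer time some survivor [u] is on a circle
    of ring [a] and some survivor [v] on a circle of ring [b].  As long as they
    starve, [u] only moves forward and [v] only backward along the cycle, so they
    eventually face each other across a link, where they meet.

    Conversely, if all robots of one ring leave before the first switch, the
    survivors all circulate in the other ring, in the same direction, and never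
    meet. *)
From Stdlib Require Import Reals ZArith Lra Lia Classical ClassicalEpsilon.
From mathcomp Require Import all_boot.
Require Import Defs.
Set Implicit Arguments. Unset Strict Implicit. Unset Printing Implicit Defensive.
Local Open Scope R_scope.

(** * Real induction, finite minima, and angles of plane vectors *)

Lemma pbP (P : Prop) : reflect P (pb P).
Proof. by rewrite /pb; case: excluded_middle_informative => h; constructor. Qed.

(** The supremum of the initial segments on which [P] holds is pushed further by the step
    hypothesis. This replaces induction on events, since runs are functions of real time. *)
Lemma real_induction (a : R) (P : R -> Prop) :
  (forall t, a <= t -> (forall s, a <= s < t -> P s) ->
     exists e, 0 < e /\ forall s, t <= s < t + e -> P s) ->
  forall t, a <= t -> P t.
Proof.
move=> step b hab; apply: NNPP => nPb.
pose E x := a <= x <= b /\ forall s, a <= s < x -> P s.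
have Ea : E a by split=> [|s hs]; lra.
have bE : bound E by exists b => x [hx _]; lra.
have [m [ub lub]] := completeness E bE (ex_intro _ a Ea).
have ham := ub a Ea.
have hmb : m <= b by apply: lub => x [hx _]; lra.
have Pm s : a <= s < m -> P s.
  move=> hs; apply: NNPP => nPs.
  suff : m <= s by lra.
  apply: lub => x [_ Px]; case: (Rle_lt_dec x s) => // hx.
  by case: nPs; apply: Px; lra.
have [e [e0 Pe]] := step m ham Pm.
case: (Rlt_le_dec b (m + e)) => hb; first by apply: nPb; apply: Pe; lra.
suff /ub : E (m + e) by lra.
split=> [|s hs]; first lra.
by case: (Rlt_le_dec s m) => hsm; [apply: Pm; lra | apply: Pe; lra].
Qed.

Lemma common_eps (I : finType) (Q : I -> R -> Prop) :
  (forall i e e', e' <= e -> Q i e -> Q i e') ->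
  (forall i, exists e, 0 < e /\ Q i e) ->
  exists e, 0 < e /\ forall i, Q i e.
Proof.
move=> Qle Qex.
suff H (l : seq I) : exists e, 0 < e /\ forall i, i \in l -> Q i e.
  have [e [e0 He]] := H (enum I).
  by exists e; split=> // i; apply: He; rewrite mem_enum.
elim: l => [|i l [e [e0 He]]]; first by exists 1; split=> //; lra.
have [e' [e'0 He']] := Qex i; exists (Rmin e e'); split.
  by apply: Rmin_glb_lt.
move=> j; rewrite inE => /orP[/eqP-> | /He].
  by apply: Qle He'; apply: Rmin_r.
by apply: Qle; apply: Rmin_l.
Qed.

Lemma no_int_between (k : Z) : ~ (0 < IZR k < 1).
Proof. by case=> /lt_IZR h1 /lt_IZR h2; lia. Qed.

Lemma direction_exists (v : pt) :
  0 < sqrt (fst v ^ 2 + snd v ^ 2) -> exists theta, is_dir theta v.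
Proof.
case: v => x y /=; set d := sqrt _ => d0.
have d2 : d * d = x * x + y * y.
  by rewrite /d sqrt_sqrt; [ring | nra].
have hx : -1 <= x / d <= 1.
  split; [apply: (Rmult_le_reg_r d) => // | apply: (Rmult_le_reg_r d) => //];
  rewrite /Rdiv Rmult_assoc Rinv_l; nra.
have hs : sin (acos (x / d)) * d = Rabs y.
  rewrite sin_acos // -[X in _ * X](sqrt_square d); last lra.
  rewrite -sqrt_mult_alt; last by rewrite /Rsqr; nra.
  rewrite -sqrt_Rsqr_abs; congr sqrt; rewrite /Rsqr.
  have -> : (1 - x / d * (x / d)) * (d * d) = d * d - x * x by field; lra.
  lra.
have hc : cos (acos (x / d)) * d = x by rewrite cos_acos //; field; lra.
case: (Rle_lt_dec 0 y) => hy.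
  exists (acos (x / d)); rewrite /is_dir /= -/d; split=> //.
  by rewrite hs Rabs_pos_eq.
exists (- acos (x / d)); rewrite /is_dir /= -/d cos_neg sin_neg; split=> //.
have := hs; rewrite Rabs_left //; lra.
Qed.

(** Equal cosines and sines give [cos (b - a) = 1]; halving the angle turns this into a zero of the
    sine. *)
Lemma direction_unique (v : pt) (a b : R) :
  0 < sqrt (fst v ^ 2 + snd v ^ 2) -> is_dir a v -> is_dir b v ->
  exists k : Z, b = a + 2 * PI * IZR k.
Proof.
rewrite /is_dir; move: (sqrt _) => d d0 [ca sa] [cb sb].
have hc : cos a = cos b by apply: (Rmult_eq_reg_r d); lra.
have hs : sin a = sin b by apply: (Rmult_eq_reg_r d); lra.
have h1 : cos (b - a) = 1.
  by rewrite cos_minus hc hs; have := sin2_cos2 b; rewrite /Rsqr; lra.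
have h2 : sin ((b - a) / 2) = 0.
  have := cos_2a_sin ((b - a) / 2).
  have -> : 2 * ((b - a) / 2) = b - a by field.
  rewrite h1; nra.
have [k hk] := sin_eq_0_0 _ h2.
by exists k; lra.
Qed.

Lemma cos_sin_period (a : R) (k : Z) :
  cos (a + 2 * PI * IZR k) = cos a /\ sin (a + 2 * PI * IZR k) = sin a.
Proof.
have pos (b : R) (m : nat) :
    cos (b + 2 * PI * INR m) = cos b /\ sin (b + 2 * PI * INR m) = sin b.
  have -> : b + 2 * PI * INR m = b + 2 * INR m * PI by ring.
  by rewrite cos_period sin_period.
case: (Z_le_gt_dec 0 k) => hk.
  by have := pos a (Z.to_nat k); rewrite INR_IZR_INZ Z2Nat.id.
(* A negative [k] is undone by a positive number of turns from the shifted angle. *)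
have := pos (a + 2 * PI * IZR k) (Z.to_nat (- k)).
rewrite INR_IZR_INZ Z2Nat.id; last lia.
rewrite opp_IZR.
have -> : a + 2 * PI * IZR k + 2 * PI * - IZR k = a by ring.
by case.
Qed.

(** * Times at which link positions are reached *)

Section Links.
Variables (n : nat) (c : 'I_n -> pt) (r : R) (f g : 'I_n -> R).
Hypothesis disj : disjoint_unit_circles c.
Hypothesis sync : sync_schedule c r f g.

Notation adj := (comm_adj c r).
Notation link := (at_link c f g).

Let vec (i j : 'I_n) : pt := (fst (c j) - fst (c i), snd (c j) - snd (c i)).

Lemma norm_vec (i j : 'I_n) :
  sqrt (fst (vec i j) ^ 2 + snd (vec i j) ^ 2) = dist (c i) (c j).
Proof. by rewrite /dist; congr sqrt => /=; ring. Qed.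

Lemma adj_dist (i j : 'I_n) : adj i j -> 2 < dist (c i) (c j) <= 2 + r.
Proof. by case=> /disj h1 h2. Qed.

Lemma norm_vec_gt0 (i j : 'I_n) :
  adj i j -> 0 < sqrt (fst (vec i j) ^ 2 + snd (vec i j) ^ 2).
Proof. by rewrite norm_vec => /adj_dist; lra. Qed.

Lemma adj_sym (i j : 'I_n) : adj i j -> adj j i.
Proof.
case=> neq h; split; first by move=> e; apply: neq.
suff -> : dist (c j) (c i) = dist (c i) (c j) by [].
by rewrite /dist; congr sqrt; ring.
Qed.

Lemma link_sym (i j : 'I_n) (t : R) : adj i j -> link i j t -> link j i t.
Proof. by move=> /(proj2 sync)[_ h]; case: (h t). Qed.

Lemma link_period (i j : 'I_n) (t : R) (k : Z) :
  link i j t -> link i j (t + IZR k).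
Proof.
rewrite /at_link /is_dir /sched_pos => h.
have [m ->] : exists m : Z, f i + g i * 2 * PI * (t + IZR k) =
    f i + g i * 2 * PI * t + 2 * PI * IZR m.
  case: (proj1 sync i) => ->; first by exists k; ring.
  by exists (- k)%Z; rewrite opp_IZR; ring.
by have [-> ->] := cos_sin_period (f i + g i * 2 * PI * t) m.
Qed.

Lemma link_exists (i j : 'I_n) : adj i j -> exists t, link i j t.
Proof.
move=> /norm_vec_gt0/direction_exists[th Hth].
exists (g i * (th - f i) / (2 * PI)); rewrite /at_link /sched_pos.
suff -> : f i + g i * 2 * PI * (g i * (th - f i) / (2 * PI)) = th by [].
have := PI_RGT_0; case: (proj1 sync i) => -> h; field; lra.
Qed.

Lemma link_congr (i j : 'I_n) (t t' : R) :
  adj i j -> link i j t -> link i j t' -> exists k : Z, t' = t + IZR k.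
Proof.
move=> /norm_vec_gt0/direction_unique H h1 h2.
have [k] := H _ _ h1 h2; rewrite /sched_pos => hk.
have pi0 := PI_RGT_0.
case: (proj1 sync i) hk => -> hk.
  by exists k; apply: (Rmult_eq_reg_l (2 * PI)); lra.
by exists (- k)%Z; rewrite opp_IZR; apply: (Rmult_eq_reg_l (2 * PI)); lra.
Qed.

(* Two neighbours seen in the same direction are within [2 + r] of each other,
   and a triangle has no alternating choice of directions. *)
Lemma link_inj (i j k : 'I_n) (t : R) :
  adj i j -> adj i k -> link i j t -> link i k t -> j = k.
Proof.
move=> ij ik; rewrite /at_link /is_dir -/(vec i j) -/(vec i k) !norm_vec /=.
have := adj_dist ij; have := adj_dist ik.
move: (dist (c i) (c j)) (dist (c i) (c k)) => d d' hd hd' [cj sj] [ck sk].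
apply: NNPP => jk.
have jk_adj : adj j k.
  split=> //; apply: (Rle_trans _ (Rabs (d - d'))); last first.
    by apply: Rabs_le; lra.
  rewrite -sqrt_Rsqr_abs /dist; apply: Req_le; congr sqrt; rewrite /Rsqr.
  set th := sched_pos f g i t in cj sj ck sk.
  have -> : fst (c j) - fst (c k) = cos th * (d - d') by lra.
  have -> : snd (c j) - snd (c k) = sin th * (d - d') by lra.
  have := sin2_cos2 th; rewrite /Rsqr => h.
  transitivity ((sin th * sin th + cos th * cos th) * ((d - d') * (d - d'))).
    by ring.
  by rewrite h; ring.
have := proj1 (proj2 sync _ _ ij); have := proj1 (proj2 sync _ _ ik).
have := proj1 (proj2 sync _ _ jk_adj).
by case: (proj1 sync i); lra.
Qed.

Lemma next_link (i j : 'I_n) (t : R) : adj i j ->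
  exists s, t < s <= t + 1 /\ link i j s /\
    forall s', t < s' < s -> ~ link i j s'.
Proof.
move=> ij; have [t0 h0] := link_exists ij.
have [u1 u2] := archimed (t - t0).
(* [up] exceeds its argument strictly and by at most 1, so this is the first translate of [t0] after
   [t]. *)
exists (t0 + IZR (up (t - t0))); split; first lra.
have h1 := link_period (up (t - t0)) h0; split=> // s' hs' h2.
have [k hk] := link_congr ij h2 h1.
by apply: (@no_int_between k); lra.
Qed.

(** Occurrences of a link are one unit apart, so at most one lies in [(t - 1, t)], and the gap can
    start there. *)
Lemma link_free_left (i j : 'I_n) (t : R) : adj i j ->
  exists e, 0 < e /\ forall s, t - e < s < t -> ~ link i j s.
Proof.
move=> ij.
case: (classic (exists2 s, t - 1 < s < t & link i j s)) => [[s hs h]|no].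
  exists (t - s); split=> [|s' hs' h']; first lra.
  have [k hk] := link_congr ij h h'.
  by apply: (@no_int_between k); lra.
by exists 1; split=> [|s hs h]; [lra | apply: no; exists s].
Qed.

End Links.

(** * Neighbours along the cycle and first links *)

Section Cycle.
Variables (n : nat) (c : 'I_n -> pt) (r : R) (f g : 'I_n -> R).
Hypothesis disj : disjoint_unit_circles c.
Hypothesis sync : sync_schedule c r f g.

Notation adj := (comm_adj c r).
Notation link := (at_link c f g).

(** Keeping [nxt] with its inverse makes the setting symmetric: swapping the two maps swaps the
    rings, so a fact proved for one serves for the other. *)
Record cyclic_neighbours (nxt prv : 'I_n -> 'I_n) : Prop := CyclicNeighbours {
  nxtK : cancel nxt prv;
  prvK : cancel prv nxt;
  adjP : forall i j, adj i j <-> j = nxt i \/ j = prv i;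
  nxt_neq_prv : forall i, nxt i <> prv i;
  nxt_orbit : forall i j, exists k, iter k nxt i = j }.

Lemma cyclic_neighbours_sym nxt prv :
  cyclic_neighbours nxt prv -> cyclic_neighbours prv nxt.
Proof.
case=> nK pK aP nEp orb; split=> //.
- by move=> i j; rewrite aP; tauto.
- by move=> i /esym; apply: nEp.
move=> i j; have [k <-] := orb j i; exists k.
elim: k => [|k IH] //; by rewrite iterSr iterS nK.
Qed.

Lemma cycle_order_neighbours nxt : (3 <= n)%N -> cycle_order c r nxt ->
  exists prv, cyclic_neighbours nxt prv.
Proof.
move=> n3 [inj [orb aP]]; exists (invF inj).
have nK := f_invF inj; have pK := invF_f inj.
have aP' i j : adj i j <-> j = nxt i \/ j = invF inj i.
  rewrite aP; split=> -[->|->]; [by left | right | by left | right].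
    by rewrite pK.
  by rewrite nK.
split=> // i e.
(* Otherwise the orbit of [i] has at most two circles, against [3 <= n]. *)
have n2 : nxt (nxt i) = i by rewrite e nK.
have sub : {subset 'I_n <= [:: i; nxt i]}.
  move=> j _; have [k <-] := orb i j.
  elim: k => [|k] /=; first by rewrite inE eqxx.
  rewrite !inE => /orP[/eqP-> | /eqP->]; first by rewrite eqxx orbT.
  by rewrite n2 eqxx.
have := leq_trans (subset_leq_card (introT subsetP sub)) (card_size _).
by rewrite card_ord leqNgt n3.
Qed.

(* [first_link c r f g i j] is [exists s, first_link_after 0 i j s]. *)
Definition first_link_after (t : R) (i j : 'I_n) (s : R) : Prop :=
  t < s /\ link i j s /\
  forall s' k, t < s' < s -> adj i k -> ~ link i k s'.

Lemma first_link_shift i j (m : Z) :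
  first_link c r f g i j -> exists s, first_link_after (IZR m) i j s.
Proof.
case=> s [s0 [hs no]]; exists (s + IZR m); split; first lra.
split; first exact: (link_period sync).
move=> s' k hs' ik h; apply: (no (s' - IZR m) k) => //; first lra.
have := link_period sync (- m) h; rewrite opp_IZR.
by have -> : s' + - IZR m = s' - IZR m by ring.
Qed.

Lemma first_link_after_unique t i j k s s' : adj i j -> adj i k ->
  first_link_after t i j s -> first_link_after t i k s' -> j = k.
Proof.
move=> ij ik [ts [hs no]] [ts' [hs' no']].
case: (Rtotal_order s s') => [h|[e|h]].
- by case: (no' s j).
- by move: hs'; rewrite -e => hs'; apply: (link_inj disj sync ij ik hs).
- by case: (no s' k).
Qed.

Section Direction.
Variables nxt prv : 'I_n -> 'I_n.
Hypothesis cyc : cyclic_neighbours nxt prv.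

Lemma adj_nxt i : adj i (nxt i).
Proof. by apply/(adjP cyc); left. Qed.

Lemma adj_prv i : adj i (prv i).
Proof. by apply/(adjP cyc); right. Qed.

Lemma link_nxt_prv i t : link i (nxt i) t -> link i (prv i) t -> False.
Proof.
move=> h h'; apply: (nxt_neq_prv cyc (i := i)).
exact: (link_inj disj sync (adj_nxt i) (adj_prv i) h h').
Qed.

Lemma first_link_after_exists t i :
  (exists s, first_link_after t i (nxt i) s) \/ (exists s, first_link_after t i (prv i) s).
Proof.
have [s [hs [ls no]]] := next_link disj sync t (adj_nxt i).
have [s' [hs' [ls' no']]] := next_link disj sync t (adj_prv i).
case: (Rtotal_order s s') => [h|[e|h]].
- left; exists s; split; first lra.
  split=> // x k hx /(adjP cyc) [->|->]; first by apply: no; lra.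
  by apply: no'; lra.
- by case: (link_nxt_prv ls); rewrite e.
- right; exists s'; split; first lra.
  split=> // x k hx /(adjP cyc) [->|->]; last by apply: no'; lra.
  by apply: no; lra.
Qed.

(** The link to [nxt i] occurs within one period of [t], and the link to [prv i] recurs no earlier
    than that. Hence a robot that always switches stays in its ring. *)
Lemma first_link_after_step i t :
  link i (prv i) t -> exists s, first_link_after t i (nxt i) s.
Proof.
move=> h; have [s [hs [ls no]]] := next_link disj sync t (adj_nxt i).
exists s; split; first lra.
split=> // x k hx /(adjP cyc) [->|->]; first by apply: no; lra.
move=> h'; have [m hm] := link_congr disj sync (adj_prv i) h h'.
by apply: (@no_int_between m); lra.
Qed.

Lemma first_link_after_step_nxt i t :
  link i (nxt i) t -> exists s, first_link_after t (nxt i) (nxt (nxt i)) s.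
Proof.
move=> /(link_sym sync (adj_nxt i)) h; apply: first_link_after_step.
by rewrite (nxtK cyc).
Qed.

(* If every circle met its predecessor first, the first meeting times would
   strictly decrease along the cycle. *)
Lemma exists_first_link_nxt : (0 < n)%N ->
  exists i, first_link c r f g i (nxt i).
Proof.
move=> n0; apply: NNPP => none.
have [h Hh] : exists h : 'I_n -> R, forall i, first_link_after 0 i (prv i) (h i).
  apply: (choice (fun i s => first_link_after 0 i (prv i) s)) => i.
  by case: (first_link_after_exists 0 i) => // H; case: none; exists i.
have lt i : h (prv i) < h i.
  (* The link of [i] to [prv i] at time [h i] is also the forward link of [prv i], which must come
     after the first link of [prv i], at [h (prv i)]. *)
  have [p0 [_ no]] := Hh (prv i); have [i0 [li _]] := Hh i.
  have l : link (prv i) (nxt (prv i)) (h i).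
    by rewrite (prvK cyc); apply: (link_sym sync (adj_prv i)).
  case: (Rtotal_order (h (prv i)) (h i)) => [//|[e|lt]].
    by case: (link_nxt_prv l); rewrite -e; case: (Hh (prv i)) => _ [].
  by case: (no (h i) (nxt (prv i))) => //; apply: adj_nxt.
have lti i k : h (iter k.+1 prv i) < h i.
  elim: k => [|k IH] /=; first exact: lt.
  by apply: Rlt_trans IH; apply: lt.
have [k hk] := nxt_orbit (cyclic_neighbours_sym cyc) (prv (Ordinal n0)) (Ordinal n0).
have := lti (Ordinal n0) k; rewrite iterSr hk; lra.
Qed.

End Direction.

(** * Arbitrary runs: occupancy of circles and meetings *)

Section Run.
Variables (S : {set 'I_n}) (tau : 'I_n -> R) (loc : R -> 'I_n -> 'I_n).
Hypothesis Hrun : run c r f g S tau loc.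

Lemma left_loc_common a t u v i j : a < t ->
  left_loc loc t u i -> left_loc loc t v j ->
  exists s, a < s < t /\ loc s u = i /\ loc s v = j.
Proof.
move=> lt [e [e0 h]] [e' [e'0 h']].
have at0 : 0 < t - a by lra.
have m0 := Rmin_glb_lt _ _ _ (Rmin_glb_lt _ _ _ e0 e'0) at0.
have := Rmin_l e e'; have := Rmin_r e e'.
have := Rmin_l (Rmin e e') (t - a); have := Rmin_r (Rmin e e') (t - a).
move=> m1 m2 m3 m4.
exists (t - Rmin (Rmin e e') (t - a) / 2); split; first lra.
by split; [apply: h | apply: h']; lra.
Qed.

Lemma left_loc_unique t u i j :
  left_loc loc t u i -> left_loc loc t u j -> i = j.
Proof.
move=> hi hj; have lt : t - 1 < t by lra.
by have [s [_ [<- <-]]] := left_loc_common lt hi hj.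
Qed.

Lemma alive_le u t t' : t' <= t -> alive S tau u t -> alive S tau u t'.
Proof. by move=> le [h|h]; [left | right; lra]. Qed.

Lemma run_move t u i : alive S tau u t -> left_loc loc t u i ->
  loc t u = i \/
  exists j, [/\ adj i j, link i j t, empty_at S tau loc t j & loc t u = j].
Proof.
move=> al hl; have [mv stay] := proj2 (proj2 (proj2 Hrun)) _ _ _ al hl.
case: (classic (exists j, [/\ adj i j, link i j t & empty_at S tau loc t j])).
  by case=> j [h1 h2 h3]; right; exists j; split=> //; apply: mv.
by move=> no; left; apply: stay => j h1 h2 h3; apply: no; exists j.
Qed.

(** A robot only enters a circle found empty, so it cannot join one that stays. Two robots entering
    the same circle would put that circle at two links at once, contrary to [link_inj]. *)
Lemma run_move_inj t u v i j : i <> j ->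
  alive S tau u t -> alive S tau v t ->
  left_loc loc t u i -> left_loc loc t v j -> loc t u <> loc t v.
Proof.
move=> ij au av lu lv.
case: (run_move au lu) => [->|[k [ik lk ek ->]]];
  case: (run_move av lv) => [->|[l [jl ll el ->]]] //.
- by move=> e; case: (el u au); rewrite -e.
- by move=> e; case: (ek v av); rewrite e.
move=> e; case: ij; rewrite -{}e in jl ll.
apply: (link_inj disj sync (adj_sym ik) (adj_sym jl) (t := t)).
  exact: (link_sym sync).
exact: (link_sym sync).
Qed.

Lemma loc_inj t u v : alive S tau u t -> alive S tau v t ->
  loc t u = loc t v -> u = v.
Proof.
have [init [rc [ll _]]] := Hrun.
move=> au av e; apply: NNPP => uv.
pose P t := alive S tau u t -> alive S tau v t -> loc t u <> loc t v.
(* The base [Rmin t (-1)] lies before time 0, where every robot is on its own circle, and not after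
   [t]. *)
suff H x : Rmin t (-1) <= x -> P x by case: (H t (Rmin_l _ _) au av).
apply: real_induction => {e au av} {}x hx IH.
have m1 := Rmin_r t (-1).
case: (Rlt_le_dec x 0) => x0.
  exists (- x); split=> [|s hs _ _]; first lra.
  by rewrite !init //; lra.
have [eu [eu0 hu]] := rc x u; have [ev [ev0 hv]] := rc x v.
exists (Rmin eu ev); split=> [|s hs au av]; first exact: Rmin_glb_lt.
have := Rmin_l eu ev; have := Rmin_r eu ev => mr ml.
rewrite hu ?hv; try lra.
have [i li] := ll x u; have [j lj] := ll x v.
have au' : alive S tau u x by apply: alive_le au; lra.
have av' : alive S tau v x by apply: alive_le av; lra.
apply: (run_move_inj _ au' av' li lj) => ij.
have lt : Rmin t (-1) < x by lra.
have [y [hy [yi yj]]] := left_loc_common lt li lj.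
have hy' : Rmin t (-1) <= y < x by lra.
apply: (IH y hy'); last by rewrite yi yj.
  by apply: alive_le au'; lra.
by apply: alive_le av'; lra.
Qed.

Lemma loc_stay u t s : u \notin S ->
  (forall s' k, t < s' < s -> adj (loc t u) k -> ~ link (loc t u) k s') ->
  forall x, t <= x < s -> loc x u = loc t u.
Proof.
move=> uS no; have [_ [rc [_ rule]]] := Hrun.
suff H x : t <= x -> x < s -> loc x u = loc t u by move=> x [h1 h2]; apply: H.
move: x; apply: real_induction => x hx IH.
case: (Rlt_le_dec x s) => xs; last by exists 1; split=> [|y hy ys]; lra.
have [e [e0 he]] := rc x u.
exists e; split=> // y hy _; rewrite he //.
case: (Rle_lt_or_eq_dec _ _ hx) => [lt|-> //].
have au : alive S tau u x by left.
have lu : left_loc loc x u (loc t u).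
  by exists (x - t); split=> [|z hz]; [lra | apply: IH; lra].
have [_ stay] := rule _ _ _ au lu.
by apply: stay => k ik lk _; case: (no x k).
Qed.

Lemma left_loc_stay u t s : u \notin S -> t < s ->
  (forall s' k, t < s' < s -> adj (loc t u) k -> ~ link (loc t u) k s') ->
  left_loc loc s u (loc t u).
Proof.
move=> uS ts no; exists (s - t); split=> [|x hx]; first lra.
by apply: (loc_stay uS no); lra.
Qed.

(* [d] is the number of steps from [u], moving forward, to [v], moving
   backward; it cannot jump over zero without a meeting. *)
Lemma opposite_robots_meet nxt prv T u v : cyclic_neighbours nxt prv ->
  starvation_from c r f g S tau loc T -> u \notin S -> v \notin S ->
  forall d t su sv, T <= t ->
    first_link_after t (loc t u) (nxt (loc t u)) su ->
    first_link_after t (loc t v) (prv (loc t v)) sv ->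
    iter d nxt (loc t u) = loc t v -> False.
Proof.
move=> cyc starve uS vS d.
have rule := proj2 (proj2 (proj2 Hrun)).
have cyc' := cyclic_neighbours_sym cyc.
have an i := adj_nxt cyc i; have ap i := adj_prv cyc i.
have au x : alive S tau u x by left.
have av x : alive S tau v x by left.
elim/ltn_ind: d => d IH t su sv Tt fu fv e.
have [tu [lu nou]] := fu; have [tv [lv nov]] := fv.
(* At distance zero, one circle would have two different first links. *)
case: d => [|d] in IH e *.
  rewrite /= in e; rewrite -e in fv.
  exact: (nxt_neq_prv cyc (first_link_after_unique (an _) (ap _) fu fv)).
have step_u : left_loc loc su u (loc t u) /\
    empty_at S tau loc su (nxt (loc t u)) /\ loc su u = nxt (loc t u).
  have h := left_loc_stay uS tu nou.
  have he : empty_at S tau loc su (nxt (loc t u)).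
    by apply: (starve u uS su (loc t u)) => //; lra.
  by split=> //; split=> //; apply: (proj1 (rule _ _ _ (au su) h)).
have step_v : left_loc loc sv v (loc t v) /\
    empty_at S tau loc sv (prv (loc t v)) /\ loc sv v = prv (loc t v).
  have h := left_loc_stay vS tv nov.
  have he : empty_at S tau loc sv (prv (loc t v)).
    by apply: (starve v vS sv (loc t v)) => //; lra.
  by split=> //; split=> //; apply: (proj1 (rule _ _ _ (av sv) h)).
have [fu' hfu'] := first_link_after_step_nxt cyc lu.
have [fv' hfv'] := first_link_after_step_nxt cyc' lv.
have e' : iter d nxt (nxt (loc t u)) = loc t v by rewrite -iterSr.
(* The robot with the earlier link moves alone and shortens the distance by one; simultaneous moves
   shorten it by two, hence the strong induction. *)
case: (Rtotal_order su sv) => [lt|[eq|lt]].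
- have [h1 [h2 h3]] := step_u.
  have hv : loc su v = loc t v by apply: (loc_stay vS nov); lra.
  apply: (IH d _ su fu' sv); rewrite ?h3 ?hv //; first lra.
  by split=> //; split=> // x k hx; apply: nov; lra.
- have [h1 [h2 h3]] := step_u.
  have [h4 [h5 h6]] := step_v.
  rewrite -eq in h4 h5 h6 hfv'.
  (* At distance one the robots face each other: the circle that starvation declares empty for [u]
     holds [v]. *)
  case: d => [|d] in IH e e' *.
    by rewrite /= in e'; case: (h2 v (av su)); rewrite e'.
  apply: (IH d _ su fu' fv'); rewrite ?h3 ?h6 //; first lra.
  by rewrite -e' /= (nxtK cyc).
have [h1 [h2 h3]] := step_v.
have hu : loc sv u = loc t u by apply: (loc_stay uS nou); lra.
apply: (IH d _ sv su fv'); rewrite ?h3 ?hu //; first lra.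
  by split=> //; split=> // x k hx; apply: nou; lra.
by rewrite -e iterS (nxtK cyc).
Qed.

(** Pigeonhole: by [loc_inj] the survivors occupy distinct circles, too many to fit in the
    complement of [A]. *)
Lemma alive_occupies (A : {set 'I_n}) t : (#|S| < #|A|)%N ->
  exists2 u, u \notin S & loc t u \in A.
Proof.
move=> lt.
apply: NNPP => none.
have inj : {in ~: S &, injective (loc t)}.
  by move=> u v; rewrite !inE => uS vS; apply: loc_inj; left.
have sub : loc t @: (~: S) \subset ~: A.
  apply/subsetP => _ /imsetP[u uS ->]; rewrite inE; apply/negP => uA.
  by apply: none; exists u => //; rewrite inE in uS.
have := subset_leq_card sub; rewrite (card_in_imset inj).
have := cardsC S; have := cardsC A; move=> <- /eqP h le.
move: lt; rewrite ltnNge -(leq_add2r #|~: A|) -(eqP h).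
by rewrite leq_add2l le.
Qed.

Lemma not_starving nxt prv : cyclic_neighbours nxt prv ->
  (#|S| < #|[set i | pb (first_link c r f g i (nxt i))]|)%N ->
  (#|S| < #|[set i | pb (first_link c r f g i (prv i))]|)%N ->
  ~ falls_into_starvation c r f g S tau loc.
Proof.
move=> cyc Sa Sb [T starve].
pose m := up T; have [Tm _] := archimed T.
have [u uS] := alive_occupies (IZR m) Sa.
rewrite inE => /pbP/(first_link_shift m)[su fu].
have [v vS] := alive_occupies (IZR m) Sb.
rewrite inE => /pbP/(first_link_shift m)[sv fv].
have [d hd] := nxt_orbit cyc (loc (IZR m) u) (loc (IZR m) v).
have Tm' : T <= IZR m by rewrite /m; lra.
exact: (opposite_robots_meet cyc starve uS vS Tm' fu fv hd).
Qed.
End Run.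

(** * Construction of a starving run *)

Section Survivors.
Variables nxt prv : 'I_n -> 'I_n.
Hypothesis cyc : cyclic_neighbours nxt prv.

Definition next_time (i : 'I_n) (t : R) : R :=
  epsilon (inhabits 0) (first_link_after t i (nxt i)).

(** Itinerary of a survivor that always switches: it is on [iter m nxt u] from [enter_time u m]
    until [leave_time u m]. *)
Fixpoint leave_time (u : 'I_n) (m : nat) : R :=
  if m is m'.+1 then next_time (iter m nxt u) (leave_time u m')
  else next_time u 0.

Definition enter_time (u : 'I_n) (m : nat) : R :=
  if m is m'.+1 then leave_time u m' else 0.

Lemma first_link_after_leave u m : first_link c r f g u (nxt u) ->
  first_link_after (enter_time u m) (iter m nxt u) (iter m.+1 nxt u) (leave_time u m).
Proof.
move=> fu; elim: m => [|m [_ [IH _]]]; first exact: epsilon_spec.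
by apply: epsilon_spec; apply: (first_link_after_step_nxt cyc).
Qed.

(** Switches cannot accumulate at a time [x]: a short window before [x] is free of forward links of
    all circles, so a leave time beyond a point of the window is at least [x], and the next one is
    larger. *)
Lemma leave_time_unbounded u t : first_link c r f g u (nxt u) ->
  exists m, t < leave_time u m.
Proof.
move=> fu; have lf m := first_link_after_leave m fu.
have [l0 _] := lf 0%N.
case: (Rlt_le_dec t 0) => t0; first by exists 0%N; rewrite /= in l0 *; lra.
move: t t0; apply: real_induction => x x0 IH.
suff [m hm] : exists m, x < leave_time u m.
  by exists (leave_time u m - x); split=> [|s hs]; [lra | exists m; lra].
have [e [e0 free]] : exists e, 0 < e /\
    forall i s, x - e < s < x -> ~ link i (nxt i) s.
  apply: (common_eps (Q := fun i e => forall s, x - e < s < x -> _)).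
    by move=> i e e' le h s hs; apply: h; lra.
  by move=> i; apply: (link_free_left disj sync); apply: (adj_nxt cyc).
case: (Rle_lt_or_eq_dec _ _ x0) => [xp|<-]; last by exists 0%N.
have [y hy ey] : exists2 y, 0 <= y < x & x - e < y.
  exists (Rmax 0 (x - e / 2)).
    by split; [apply: Rmax_l | apply: Rmax_lub_lt; lra].
  by have := Rmax_r 0 (x - e / 2); lra.
have [m hm] := IH y hy.
case: (Rtotal_order x (leave_time u m)) => [lt|[eq|lt]]; first by exists m.
  by exists m.+1; rewrite {1}eq; case: (lf m.+1).
by have [_ [l _]] := lf m; case: (free _ (leave_time u m) _ l); lra.
Qed.

(** Descending from [m] while [Q] holds finds the itinerary interval containing a time: [Rlt t]
    serves for the value at [t], [Rle t] for the left limit. *)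
Lemma leave_time_index (Q : R -> Prop) u m : Q (leave_time u m) ->
  exists k, Q (leave_time u k) /\ (k = 0%N \/ ~ Q (enter_time u k)).
Proof.
elim: m => [|m IH] h; first by exists 0%N; split=> //; left.
case: (classic (Q (leave_time u m))) => [/IH // | no].
by exists m.+1; split=> //; right.
Qed.

Lemma leave_time_mono u m k : first_link c r f g u (nxt u) ->
  (m <= k)%N -> leave_time u m <= leave_time u k.
Proof.
move=> fu /subnK <-; elim: (k - m)%N => [|d IH]; first exact: Rle_refl.
have [lt _] := first_link_after_leave (d + m).+1 fu.
by rewrite addSn; apply: Rle_trans IH (Rlt_le _ _ lt).
Qed.

Variable S : {set 'I_n}.
Hypothesis survivors : forall u, u \notin S -> first_link c r f g u (nxt u).

(** Robots of [S] stay parked on their own circles: once they are gone, neither the switching rule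
    nor [empty_at] looks at them. The alternative [m = 0] covers negative times. *)
Definition ring_loc (t : R) (u : 'I_n) : 'I_n :=
  if u \in S then u else
  iter (epsilon (inhabits 0%N)
    (fun m => t < leave_time u m /\ (m = 0%N \/ ~ t < enter_time u m))) nxt u.

(** Leave times are monotone, so the condition under [epsilon] has only one solution. *)
Lemma ring_loc_eq t u m : u \notin S -> t < leave_time u m ->
  m = 0%N \/ enter_time u m <= t -> ring_loc t u = iter m nxt u.
Proof.
move=> uS tm em; rewrite /ring_loc (negPf uS); congr iter.
have := epsilon_spec (inhabits 0%N) _ (leave_time_index (Q := Rlt t) tm).
move: (epsilon _ _) => k [tk ek]; have fu := survivors uS.
case: (ltngtP k m) => // [km|mk].
  case: em => [m0|em]; first by rewrite m0 in km.
  case: m em km {tm} => // m em km; have := leave_time_mono fu (km : (k <= m)%N).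
  by rewrite /= in em => h; exfalso; lra.
case: ek => [k0|ek]; first by rewrite k0 in mk.
case: k ek mk {tk} => // k ek mk; have := leave_time_mono fu (mk : (m <= k)%N).
by rewrite /= in ek => h; exfalso; lra.
Qed.

Lemma left_ring_loc t u i : u \notin S -> left_loc ring_loc t u i ->
  exists m, [/\ i = iter m nxt u, t <= leave_time u m &
                m = 0%N \/ enter_time u m < t].
Proof.
move=> uS li; have fu := survivors uS.
have [m0 h0] := leave_time_unbounded t fu.
have [m [tm em]] := leave_time_index (Q := Rle t) (Rlt_le _ _ h0).
have {}em : m = 0%N \/ enter_time u m < t by case: em => h; [left|right; lra].
exists m; split=> //; apply: (left_loc_unique li).
case: em => em; last first.
  exists (t - enter_time u m); split=> [|s hs]; first lra.
  by apply: ring_loc_eq => //; [lra | right; lra].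
exists 1; split=> [|s hs]; first lra.
by apply: ring_loc_eq => //; [lra | left].
Qed.

(** No link is met strictly inside an itinerary interval, so [t] is a leave time, and [link_inj]
    identifies [j]. *)
Lemma left_ring_loc_link t u i j : u \notin S -> 0 < t ->
  left_loc ring_loc t u i -> adj i j -> link i j t ->
  j = nxt i /\ ring_loc t u = j.
Proof.
move=> uS t0 /(left_ring_loc uS)[m [-> tm em]] ij lj.
have lf k := first_link_after_leave k (survivors uS).
have em' : enter_time u m < t by case: em => // ->.
have [_ [lm no]] := lf m.
have eq : t = leave_time u m.
  by case: (Rle_lt_or_eq_dec _ _ tm) => // lt; case: (no t j).
have -> : j = nxt (iter m nxt u).
  by apply: (link_inj disj sync ij (adj_nxt cyc _) lj); rewrite eq.
split=> //; apply: (ring_loc_eq (m := m.+1)) => //.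
  by rewrite {1}eq; case: (lf m.+1).
by right; rewrite eq; apply: Rle_refl.
Qed.

(* All robots of [S] leave at one time, before any survivor first moves. *)
Lemma starving_run : exists tau loc,
  [/\ forall u, u \in S -> 0 <= tau u, run c r f g S tau loc &
      falls_into_starvation c r f g S tau loc].
Proof.
have [e [e0 he]] : exists e, 0 < e /\
    forall u, u \notin S -> e <= leave_time u 0.
  apply: (common_eps (Q := fun u e => u \notin S -> e <= leave_time u 0)).
    by move=> u e e' le h uS; have := h uS; lra.
  move=> u; case: (boolP (u \in S)) => uS; first by exists 1; split=> //; lra.
  exists (leave_time u 0); split=> [|_]; last exact: Rle_refl.
  by have [] := first_link_after_leave 0 (survivors uS).
have home t u : t < e -> ring_loc t u = u.
  move=> te; case: (boolP (u \in S)) => uS; first by rewrite /ring_loc uS.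
  by apply: (ring_loc_eq (m := 0)) => //; [have := he u uS; lra | left].
have left_home t u : t <= e -> left_loc ring_loc t u u.
  by move=> te; exists 1; split=> [|s hs]; [lra | apply: home; lra].
pose tau (u : 'I_n) := e.
have survives u t : e <= t -> alive S tau u t -> u \notin S.
  by move=> et [// | h]; rewrite /tau in h; lra.
(* A survivor on [j] would be at its link to [i]; both robots go forward, so [j = nxt i] and
   [i = nxt j], making [nxt i] and [prv i] equal. *)
have empty t u i j : e <= t -> u \notin S -> left_loc ring_loc t u i ->
    adj i j -> link i j t -> empty_at S tau ring_loc t j.
  move=> et uS lu ij lj v av lv; have vS := survives v t et av.
  have t0 : 0 < t by lra.
  have [ej _] := left_ring_loc_link uS t0 lu ij lj.
  have [ei _] := left_ring_loc_link vS t0 lv (adj_sym ij) (link_sym sync ij lj).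
  apply: (nxt_neq_prv cyc (i := i)).
  by rewrite -ej [in RHS]ei (nxtK cyc).
exists tau, ring_loc; split; first by move=> u _; rewrite /tau; lra.
  split; first by move=> t u t0; apply: home; lra.
  split; last split.
  - move=> t u; case: (boolP (u \in S)) => uS.
      by exists 1; split=> [|s _]; [lra | rewrite /ring_loc uS].
    have [m0 h0] := leave_time_unbounded t (survivors uS).
    have [m [tm em]] := leave_time_index (Q := Rlt t) h0.
    have {}em : m = 0%N \/ enter_time u m <= t.
      by case: em => h; [left | right; lra].
    exists (leave_time u m - t); split=> [|s hs]; first lra.
    rewrite (ring_loc_eq uS tm em); apply: ring_loc_eq => //; first lra.
    by case: em => h; [left | right; lra].
  - move=> t u; case: (boolP (u \in S)) => uS.
      by exists u, 1; split=> [|s _]; [lra | rewrite /ring_loc uS].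
    have [m0 h0] := leave_time_unbounded t (survivors uS).
    have [m [tm em]] := leave_time_index (Q := Rle t) (Rlt_le _ _ h0).
    exists (iter m nxt u); case: em => em.
      by exists 1; split=> [|s hs]; [lra | apply: ring_loc_eq => //; [lra | left]].
    exists (t - enter_time u m); split=> [|s hs]; first lra.
    by apply: ring_loc_eq => //; [lra | right; lra].
  move=> t u i au lu; case: (Rlt_le_dec t e) => te.
    (* Before [e] all robots are present and at home, so no circle is empty and no switch is due. *)
    have te' : t <= e by lra.
    rewrite home // (left_loc_unique lu (left_home t u te')).
    split=> // j _ _ ej; case: (ej j); last exact: left_home.
    by right.
  have uS := survives u t te au; have t0 : 0 < t by lra.
  split=> [j ij lj _ | no].
    by have [] := left_ring_loc_link uS t0 lu ij lj.
  have [m [ei tm em]] := left_ring_loc uS lu.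
  case: (Rle_lt_or_eq_dec _ _ tm) => [lt | eq].
    rewrite ei; apply: ring_loc_eq => //.
    by case: em => h; [left | right; lra].
  have li : link i (nxt i) t.
    by rewrite ei eq; have [_ [l _]] := first_link_after_leave m (survivors uS).
  by case: (no _ (adj_nxt cyc i) li); apply: (empty t u i _ te uS lu (adj_nxt cyc i)).
by exists e => u uS t i j et lu ij lj; apply: (empty t u i j et uS lu ij lj).
Qed.
End Survivors.

(** * Removing a whole ring, and the exact value of the resilience *)

Lemma ring_covers_not_resilient nxt prv k : cyclic_neighbours nxt prv ->
  (k <= n)%N -> (#|[set i | pb (first_link c r f g i (prv i))]| <= k)%N ->
  ~ resilient c r f g k.
Proof.
set B := [set i | _] => cyc kn Bk [_ res].
(* [B] is filled up with arbitrary robots to exactly [k]; every survivor then meets [nxt] first. *)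
have [S [BS Sk]] : exists S : {set 'I_n}, B \subset S /\ #|S| = k.
  have : (k - #|B| <= #|~: B|)%N.
    by rewrite leq_subLR cardsC card_ord.
  case/card_geqP => l [ul sl lB]; exists (B :|: [set x in l]).
  split; first exact: subsetUl.
  have dis : B :&: [set x in l] = set0.
    apply/setP => x; rewrite in_setI !in_set0 [x \in [set _ in _]]in_set.
    by apply/negP => /andP[xB /lB]; rewrite in_setC xB.
  have cl : #|[set x in l]| = (k - #|B|)%N.
    by rewrite -sl cardsE; apply/card_uniqP.
  by rewrite cardsU dis cards0 subn0 cl subnKC.
have surv u : u \notin S -> first_link c r f g u (nxt u).
  move=> uS; case: (first_link_after_exists cyc 0 u) => // h.
  by case/negP: uS; apply: (subsetP BS); rewrite inE; apply/pbP.
have [tau [loc [t0 hrun hst]]] := starving_run cyc surv.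
exact: (res S tau Sk t0 loc hrun hst).
Qed.
End Cycle.

Theorem theorem8 (n : nat) (c : 'I_n -> pt) (r : R) (f g : 'I_n -> R)
    (nxt : 'I_n -> 'I_n) :
  0 < r ->
  disjoint_unit_circles c ->
  (3 <= n)%N ->
  cycle_order c r nxt ->
  sync_schedule c r f g ->
  isolation_resilience c r f g
    (minn (N_ring_a c r f g nxt) (N_ring_b c r f g nxt) - 1)%N.
Proof.
move=> _ disj n3 /(cycle_order_neighbours n3)[prv cyc] sync.
have cyc' := cyclic_neighbours_sym cyc.
have n0 : (0 < n)%N by apply: leq_trans n3.
have -> : N_ring_b c r f g nxt = #|[set i | pb (first_link c r f g i (prv i))]|.
  congr #|pred_of_set _|; apply/setP => i; rewrite !inE; apply/pbP/pbP.
    by case=> j [<- h]; rewrite (nxtK cyc).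
  by move=> h; exists (prv i); rewrite (prvK cyc).
rewrite /N_ring_a; set A := [set i | pb (first_link _ _ _ _ i (nxt i))].
set B := [set i | _].
(* Both rings are inhabited, so the truncated subtraction of 1 is a true one. *)
have ring_gt0 : (0 < minn #|A| #|B|)%N.
  rewrite leq_min; apply/andP; split; apply/card_gt0P.
    have [i hi] := exists_first_link_nxt disj sync cyc n0.
    by exists i; rewrite inE; apply/pbP.
  have [i hi] := exists_first_link_nxt disj sync cyc' n0.
  by exists i; rewrite inE; apply/pbP.
have lt : (minn #|A| #|B| - 1 < minn #|A| #|B|)%N.
  by rewrite subn1 ltn_predL.
split.
  split.
    apply: leq_trans (ltnW lt) _; apply: leq_trans (geq_minl _ _) _.
    by have := max_card (mem A); rewrite card_ord.
  move=> S tau Sk t0 loc hrun.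
  apply: (not_starving disj sync hrun cyc); rewrite Sk.
    exact: leq_trans lt (geq_minl _ _).
  exact: leq_trans lt (geq_minr _ _).
(* A larger [k] is at least the size of one ring, which can then be removed entirely; for ring a the
   roles of [nxt] and [prv] are exchanged. *)
move=> k resk; rewrite -ltnS subn1 prednK // ltnNge; apply/negP.
have kn := proj1 resk.
rewrite geq_min => /orP[Ak|Bk].
  exact: (ring_covers_not_resilient disj sync cyc' kn Ak resk).
exact: (ring_covers_not_resilient disj sync cyc kn Bk resk).
Qed.
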